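(* If $\psi = \varphi_w$ is a primitive Sturmian substitution such that $w \in \{b,\beta\}^* \cup \{b,\alpha\}^* \cup \{a,\beta\}^* \cup \{a,\alpha\}^*$, then $\psi$ is closeable under derivation.
   Context: Morphisms on $\{0,1\}^*$: $\varphi_a: 0\mapsto 0, 1 \mapsto 10$; $\varphi_b: 0 \mapsto 0, 1\mapsto 01$; $\varphi_\alpha: 0\mapsto 01, 1\mapsto 1$; $\varphi_\beta: 0\mapsto 10, 1 \mapsto 1$; for $w=w_0\cdots w_{m-1}$, $\varphi_w = \varphi_{w_0}\circ\cdots\circ\varphi_{w_{m-1}}$. A morphism is primitive if some power maps every letter to a word containing every letter. A substitution is a morphism $\psi$ with a letter $c$ such that $\psi(c)=cx$, $x$ nonempty, $|\psi^n(c)|\to\infty$. Derived word: for a uniformly recurrent word $\mathbf{u}$ and a factor $v$, a return word of $v$ is a factor $r$ such that $rv$ is a factor in which $v$ occurs exactly twice (as prefix and suffix); if $r_0,\dots,r_k$ are all return words, write $\mathbf{u}=p\,r_{s_0}r_{s_1}\cdots$ with $|p|$ the first occurrence of $v$; $\mathbf{d}_{\mathbf{u}}(v)=s_0s_1s_2\cdots$, up to permutation of letters. A finite set $M$ of primitive substitutions is closed under derivation if for every $\varphi\in M$, every fixed point $\mathbf{u}$ of $\varphi$ and every factor $v$ of $\mathbf{u}$, $\mathbf{d}_{\mathbf{u}}(v)$ is fixed by some primitive substitution $\psi\in M$. A primitive substitution is closeable under derivation if it belongs to some finite set closed under derivation. *)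

(* Defs.v *)
(* Letters are natural numbers; an alphabet of
   size n is {0,...,n-1}; infinite words are functions nat -> nat. *)
From Stdlib Require Import List.
From mathcomp Require Import all_boot.
Set Implicit Arguments.
Unset Strict Implicit.
Unset Printing Implicit Defensive.

Record morphism := Morph { alph : nat; img : nat -> seq nat }.

Definition morph (f : nat -> seq nat) (s : seq nat) : seq nat := flatten (map f s).

Definition iter_img (s : morphism) (p c : nat) : seq nat :=
  iter p (morph (img s)) [:: c].

Definition wf_morphism (s : morphism) : Prop :=
  forall c, c < alph s -> all (fun d => d < alph s) (img s c).

Definition primitive (s : morphism) : Prop :=
  exists p, 0 < p /\ forall a b, a < alph s -> b < alph s -> b \in iter_img s p a.

Definition is_substitution (s : morphism) : Prop :=
  exists c, c < alph s /\
    (exists x, x != [::] /\ img s c = c :: x) /\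
    (forall N, exists n, N <= size (iter_img s n c)).

Definition prefix (u : nat -> nat) (n : nat) : seq nat := mkseq u n.

(* u is a fixed point of s: u is over the alphabet and s(u) = u, i.e. the
   image of every prefix of u is a prefix of u (s is nonerasing when primitive) *)
Definition fixed_point (s : morphism) (u : nat -> nat) : Prop :=
  (forall i, u i < alph s) /\
  forall n t, t < size (morph (img s) (prefix u n)) ->
    nth 0 (morph (img s) (prefix u n)) t = u t.

Definition occurs (u : nat -> nat) (v : seq nat) (i : nat) : Prop :=
  forall t, t < size v -> u (i + t) = nth 0 v t.

Definition factor (v : seq nat) (u : nat -> nat) : Prop := exists i, occurs u v i.

Definition occurs_in (w v : seq nat) (j : nat) : Prop :=
  j + size v <= size w /\ take (size v) (drop j w) = v.

Definition return_word (u : nat -> nat) (v r : seq nat) : Prop :=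
  r != [::] /\ factor (r ++ v) u /\
  forall j, occurs_in (r ++ v) v j <-> (j = 0 \/ j = size r).

(* d is a derived word d_u(v), for some enumeration rs = [r_0;...;r_k] of all
   the return words of v (the choice of enumeration gives the "up to
   permutation of letters"):  u = p r_{d 0} r_{d 1} ..., |p| being the first
   occurrence of v, the blocks r_{d j} starting at successive occurrences
   pos j of v. *)
Definition derived_word (u : nat -> nat) (v : seq nat) (d : nat -> nat) : Prop :=
  exists (rs : seq (seq nat)) (pos : nat -> nat),
    uniq rs /\ (forall r, return_word u v r <-> r \in rs) /\
    (forall i, i < pos 0 -> ~ occurs u v i) /\
    forall j,
      [/\ d j < size rs,
          occurs u v (pos j),
          pos j.+1 = pos j + size (nth [::] rs (d j)) &
          forall t, t < size (nth [::] rs (d j)) ->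
            u (pos j + t) = nth 0 (nth [::] rs (d j)) t].

Definition closed_under_derivation (M : seq morphism) : Prop :=
  forall s, List.In s M ->
    [/\ wf_morphism s, primitive s, is_substitution s &
      forall u, fixed_point s u -> forall v, factor v u ->
        exists t, List.In t M /\ primitive t /\
          exists d, derived_word u v d /\ fixed_point t d].

Definition closeable (s : morphism) : Prop :=
  exists M : seq morphism, closed_under_derivation M /\ List.In s M.

Inductive sturm := La | Lb | Lalpha | Lbeta.

Definition phi (x : sturm) (c : nat) : seq nat :=
  match x, c with
  | La, 0 => [:: 0]     | La, _ => [:: 1; 0]
  | Lb, 0 => [:: 0]     | Lb, _ => [:: 0; 1]
  | Lalpha, 0 => [:: 0; 1] | Lalpha, _ => [:: 1]
  | Lbeta, 0 => [:: 1; 0]  | Lbeta, _ => [:: 1]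
  end.

Definition phi_w (w : seq sturm) : morphism :=
  Morph 2 (fun c => foldr (fun x s => morph (phi x) s) [:: c] w).

Definition is_b_beta (x : sturm) : bool := if x is Lb then true else if x is Lbeta then true else false.
Definition is_b_alpha (x : sturm) : bool := if x is Lb then true else if x is Lalpha then true else false.
Definition is_a_beta (x : sturm) : bool := if x is La then true else if x is Lbeta then true else false.
Definition is_a_alpha (x : sturm) : bool := if x is La then true else if x is Lalpha then true else false.

(* Main.v *)
(* Write c for the characteristic Sturmian word of a given slope.  The fixed
   points of the morphisms phi_w with w in one of the four classes are the words
   c, 0c, 1c, 01c and 10c, and deleting the first letter of one other than c
   gives a fixed point of phi_w' for a word w' of the same length in one of the
   four classes.  If u = phi_x(z) with x the first letter of w, then z is fixed
   by the morphism of the rotated word, and the occurrences in u of a nonempty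
   factor v correspond, up to a constant shift, to the occurrences of a factor
   v' of z, or of z without its first letter, so both have the same derived
   word.  Here v' is shorter than v unless v is a single letter, in which case
   finitely many rotations make it shorter.  Once v' is empty, the derived word
   is the fixed point itself.  Thus the primitive phi_w' with w' in one of the four
   classes and of the length of w form a finite closed set. *)
Require Import Defs.
From mathcomp Require Import all_boot zify.

Definition slice (u : nat -> nat) i n := mkseq (fun t => u (i + t)) n.
Definition shift (u : nat -> nat) : nat -> nat := fun i => u i.+1.
Definition binary (u : nat -> nat) := forall i, u i < 2.
Definition word_image (f : nat -> seq nat) (z u : nat -> nat) :=
  forall n, occurs u (morph f (mkseq z n)) 0.
Definition nonerasing (f : nat -> seq nat) := forall c, 0 < size (f c).

Lemma slice0 u n : slice u 0 n = mkseq u n.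
Proof. by apply: eq_mkseq. Qed.

Lemma sliceD u i m n : slice u i (m + n) = slice u i m ++ slice u (i + m) n.
Proof.
rewrite /slice /mkseq iotaD map_cat; congr (_ ++ _).
rewrite add0n -[m in LHS]addn0 iotaDl -map_comp.
by apply: eq_map => t /=; rewrite addnA.
Qed.

Lemma size_slice u i n : size (slice u i n) = n.
Proof. exact: size_mkseq. Qed.

Lemma sliceS u i n : slice u i n.+1 = u i :: slice u i.+1 n.
Proof. by rewrite -add1n sliceD addn1 /= addn0. Qed.

Lemma occursE u v i : occurs u v i <-> slice u i (size v) = v.
Proof.
split=> [H|<- t].
  apply: (eq_from_nth (x0 := 0)); rewrite size_slice // => t lt_t.
  by rewrite nth_mkseq // H.
by rewrite size_slice => lt_t; rewrite nth_mkseq.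
Qed.

Lemma occurs_slice u i n : occurs u (slice u i n) i.
Proof. by apply/occursE; rewrite size_slice. Qed.

Lemma occurs_cat u a b i :
  occurs u (a ++ b) i <-> occurs u a i /\ occurs u b (i + size a).
Proof.
rewrite !occursE size_cat sliceD; split=> [/eqP|[-> ->] //].
by rewrite eqseq_cat ?size_slice // => /andP[/eqP-> /eqP->].
Qed.

Lemma occurs_cons u c v i : occurs u (c :: v) i <-> u i = c /\ occurs u v i.+1.
Proof.
rewrite -cat1s occurs_cat /= addn1.
split=> -[H1 H2]; split=> //; first by rewrite -[i]addn0 (H1 0).
by case=> // _; rewrite addn0.
Qed.

Lemma occurs_inE u s v i j : occurs u s i ->
  occurs_in s v j <-> j + size v <= size s /\ occurs u v (i + j).
Proof.
move/occursE=> <-; rewrite /occurs_in size_slice.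
have E : j + size v <= size s ->
  take (size v) (drop j (slice u i (size s))) = slice u (i + j) (size v).
  move=> le_j; rewrite -(subnKC le_j) sliceD sliceD -catA drop_size_cat ?size_slice //.
  by rewrite take_size_cat ?size_slice.
by split=> -[le_j H]; split=> //; move: H; rewrite occursE E.
Qed.

Lemma morph_cat f a b : morph f (a ++ b) = morph f a ++ morph f b.
Proof. by rewrite /morph map_cat flatten_cat. Qed.

Lemma morph_comp f g s : morph (fun c => morph g (f c)) s = morph g (morph f s).
Proof. by elim: s => //= c s IH; rewrite -cat1s !morph_cat IH /morph /= !cats0. Qed.

Lemma size_morph_ge f s : nonerasing f -> size s <= size (morph f s).
Proof. by move=> ne; elim: s => //= c s; rewrite /morph /= size_cat; have := ne c; lia. Qed.

Definition bpos f z i := size (morph f (mkseq z i)).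

Lemma bposD f z i n : bpos f z (i + n) = bpos f z i + size (morph f (slice z i n)).
Proof. by rewrite /bpos -!slice0 sliceD morph_cat size_cat. Qed.

Lemma bposS f z i : bpos f z i.+1 = bpos f z i + size (f (z i)).
Proof. by rewrite -addn1 bposD sliceS /morph /= cats0. Qed.

Lemma bpos_lt f z i j : nonerasing f -> i < j -> bpos f z i < bpos f z j.
Proof.
move=> ne lt_ij; rewrite -(subnKC lt_ij) bposD bposS.
by have := ne (z i); lia.
Qed.

Lemma bpos_surj f z i : nonerasing f ->
  exists j t, t < size (f (z j)) /\ i = bpos f z j + t.
Proof.
move=> ne; elim: i => [|i [j [t [lt_t ->]]]].
  by exists 0, 0; rewrite ne.
have [lt_t1|ge_t1] := ltnP t.+1 (size (f (z j))); first by exists j, t.+1; rewrite addnS.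
exists j.+1, 0; rewrite ne bposS; split=> //; lia.
Qed.

Lemma image_slice f z u i n : word_image f z u -> occurs u (morph f (slice z i n)) (bpos f z i).
Proof.
move/(_ (i + n)); rewrite -slice0 sliceD morph_cat => /occurs_cat[_].
by rewrite slice0.
Qed.

Lemma image_at f z u i : word_image f z u -> occurs u (f (z i)) (bpos f z i).
Proof. by move/(image_slice _ _ _ i 1); rewrite sliceS /morph /= cats0. Qed.

Lemma image_comp f g z y u :
  word_image f z y -> word_image g y u -> word_image (fun c => morph g (f c)) z u.
Proof.
move=> ify igu n; rewrite morph_comp.
by have /occursE <- := ify n; rewrite slice0; apply: igu.
Qed.

Lemma image_exists f z : nonerasing f -> exists y, word_image f z y.
Proof.
move=> ne; exists (fun t => nth 0 (morph f (mkseq z t.+1)) t) => n t lt_t.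
rewrite add0n; have lt_t1 : t < size (morph f (mkseq z t.+1)).
  by apply: leq_trans (size_morph_ge _ _ ne); rewrite size_mkseq.
have [le_n|lt_n] := leqP t.+1 n.
  by rewrite -(subnKC le_n) -(slice0 z (_ + _)) sliceD slice0 morph_cat nth_cat lt_t1.
by rewrite -(subnKC (ltnW lt_n)) -(slice0 z (_ + _)) sliceD slice0 morph_cat nth_cat lt_t.
Qed.

Lemma image_decomp f g z u : nonerasing f ->
  word_image (fun c => morph g (f c)) z u -> exists y, word_image f z y /\ word_image g y u.
Proof.
move=> ne ifg; have [y ify] := image_exists _ z ne; exists y; split=> // n.
have := ifg n; rewrite morph_comp; have /occursE <- := ify n.
rewrite slice0; set m := size _; have le_nm : n <= m.
  by have := size_morph_ge _ (mkseq z n) ne; rewrite size_mkseq.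
by rewrite -(subnKC le_nm) -(slice0 y (_ + _)) sliceD slice0 morph_cat => /occurs_cat[].
Qed.

(* [d] codes the gaps between consecutive elements of the set [O] of positions
   by the words that [u] carries on them, with exactly two distinct words. *)
Definition coded (u : nat -> nat) (O : nat -> Prop) (d : nat -> nat) : Prop :=
  exists p : nat -> nat,
    [/\ forall i, p i < p i.+1,
        forall n, O n <-> exists i, p i = n,
        binary d,
        (exists i, d i = 0) /\ (exists i, d i = 1) &
        forall i j, d i = d j <->
          slice u (p i) (p i.+1 - p i) = slice u (p j) (p j.+1 - p j)].

Definition succ_set (O O' : nat -> Prop) := forall n, O' n <-> exists2 o, O o & n = o.+1.

Lemma coded_shift u O O' d : coded (shift u) O d -> succ_set O O' -> coded u O' d.
Proof.
move=> [p [p_lt pO bd d01 dE]] OO'; exists (fun i => (p i).+1); split=> //.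
move=> n; rewrite OO'; split=> [[o /pO[i <-] ->]|[i <-]]; first by exists i.
  by exists (p i) => //; apply/pO; exists i.
Qed.

Lemma slice_rot u c i j : u i = c -> u j = c -> i < j ->
  slice u i (j - i) = c :: slice u i.+1 (j - i.+1) /\
  slice u i.+1 (j - i) = rcons (slice u i.+1 (j - i.+1)) c.
Proof.
move=> ui uj lt_ij; rewrite -subnSK // sliceS ui; split=> //.
by rewrite -[(j - i.+1).+1]addn1 sliceD sliceS subnKC // uj cats1.
Qed.

Lemma coded_succ u O O' d c : (forall o, O o -> u o = c) -> succ_set O O' ->
  coded u O d <-> coded u O' d.
Proof.
move=> uO OO'; split.
  move=> [p [p_lt pO bd d01 dE]]; exists (fun i => (p i).+1); split=> //.
    move=> n; rewrite OO'; split=> [[o /pO[i <-] ->]|[i <-]]; first by exists i.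
    by exists (p i) => //; apply/pO; exists i.
  have up i : u (p i) = c by apply: uO; apply/pO; exists i.
  move=> i j; rewrite dE !subSS.
  have [-> ->] := slice_rot _ _ _ _ (up i) (up i.+1) (p_lt i).
  have [-> ->] := slice_rot _ _ _ _ (up j) (up j.+1) (p_lt j).
  by split=> [[->]//|/rcons_inj[->]].
move=> [p [p_lt pO bd d01 dE]].
have p0 i : 0 < p i by have /OO'[o _ ->] : O' (p i) by apply/pO; exists i.
have Op i : O (p i).-1.
  by have /OO'[o ? ->] : O' (p i) by apply/pO; exists i.
exists (fun i => (p i).-1); split=> //.
- by move=> i; have := p_lt i; have := p0 i; lia.
- move=> n; split=> [On|[i <-]] //.
  have /pO[i pi] : O' n.+1 by apply/OO'; exists n.
  by exists i; rewrite pi.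
have lt i : (p i).-1 < (p i.+1).-1 by have := p_lt i; have := p0 i; lia.
move=> i j; rewrite dE.
have E i0 : p i0.+1 - p i0 = (p i0.+1).-1 - (p i0).-1 by have := p0 i0; lia.
rewrite !E.
have [E1 E1'] := slice_rot _ _ _ _ (uO _ (Op i)) (uO _ (Op i.+1)) (lt i).
have [E2 E2'] := slice_rot _ _ _ _ (uO _ (Op j)) (uO _ (Op j.+1)) (lt j).
rewrite E1 E2 -{1}(prednK (p0 i)) -{1}(prednK (p0 j)) E1' E2'.
by split=> [/rcons_inj[->]//|[->]].
Qed.

Definition morph_inj f := forall s t, all (gtn 2) s -> all (gtn 2) t ->
  morph f s = morph f t -> s = t.

Lemma binary_slice u i n : binary u -> all (gtn 2) (slice u i n).
Proof. by move=> bu; apply/allP => c /mapP[t _ ->]; apply: bu. Qed.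

Lemma coded_image f z u O O' d : nonerasing f -> morph_inj f -> binary z ->
  word_image f z u -> (forall n, O' n <-> exists2 o, O o & n = bpos f z o) ->
  coded z O d -> coded u O' d.
Proof.
move=> ne inj bz iz OO' [p [p_lt pO bd d01 dE]].
exists (fun i => bpos f z (p i)); split=> //.
- by move=> i; apply: bpos_lt.
- move=> n; rewrite OO'; split=> [[o /pO[i <-] ->]|[i <-]]; first by exists i.
  by exists (p i) => //; apply/pO; exists i.
have E i : slice u (bpos f z (p i)) (bpos f z (p i.+1) - bpos f z (p i)) =
   morph f (slice z (p i) (p i.+1 - p i)).
  have -> : bpos f z (p i.+1) = bpos f z (p i + (p i.+1 - p i)).
    by rewrite subnKC // ltnW.
  by rewrite bposD addKn; apply/occursE; apply: image_slice.
move=> i j; rewrite dE !E; split=> [->//|].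
by apply: inj; apply: binary_slice.
Qed.

Lemma coded_all u : binary u -> (exists i, u i = 0) -> (exists i, u i = 1) ->
  coded u (occurs u [::]) u.
Proof.
move=> bu u0 u1; exists id; split=> //.
- by move=> n; split=> // _; exists n.
by move=> i j; rewrite !subSnn !sliceS; split=> [->|[]].
Qed.

Lemma increasing_lt (p : nat -> nat) i j : (forall i, p i < p i.+1) -> (p i < p j) = (i < j).
Proof.
by move=> p_lt; apply: (leqW_mono (leq_mono (homo_ltn ltn_trans p_lt))).
Qed.

Lemma coded_derived u v d : coded u (occurs u v) d -> derived_word u v d.
Proof.
move=> [p [p_lt pO bd [[i0 di0] [i1 di1]] dE]].
pose blk i := slice u (p i) (p i.+1 - p i).
have blkE i : nth [::] [:: blk i0; blk i1] (d i) = blk i.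
  case E: (d i) (bd i) => [|[|]] //= _; apply/dE; lia.
exists [:: blk i0; blk i1], p.
have occp i : occurs u v (p i) by apply/pO; exists i.
have ltp i j := increasing_lt p i j p_lt.
have rE i : occurs u (blk i ++ v) (p i).
  apply/occurs_cat; split; first exact: occurs_slice.
  by rewrite size_slice subnKC ?(ltnW (p_lt i)).
have rblk i : return_word u v (blk i).
  split; first by rewrite -size_eq0 size_slice subn_eq0 -ltnNge.
  split; first by exists (p i).
  move=> j; rewrite (occurs_inE _ _ _ _ _ (rE i)) size_cat size_slice; have lti := p_lt i; split.
    move=> [le_j /pO[m pm]].
    have : p m < p i.+2 by have := p_lt i.+1; lia.
    have : i < m.+1 by rewrite -ltp; have := p_lt m; lia.
    rewrite ltp => le_im lt_m; have [Em|Em] : m = i \/ m = i.+1 by lia.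
      by subst m; left; lia.
    by subst m; right; lia.
  case=> ->; rewrite ?addn0; first by split=> //; lia.
  by rewrite subnKC ?(ltnW lti).
split.
  rewrite /= inE andbT; apply/eqP => /dE; lia.
split.
  move=> r; split; last by rewrite !inE => /orP[] /eqP->.
  move=> [r0 [[i occr] rj]].
  have sr : 0 < size r by rewrite lt0n size_eq0.
  have occE j := occurs_inE _ _ v _ j occr.
  have [_ /pO[k pk]] := (occE 0).1 ((rj 0).2 (or_introl erefl)).
  have [_ /pO[m pm]] := (occE _).1 ((rj (size r)).2 (or_intror erefl)).
  have lt_km : k < m by rewrite -ltp; lia.
  have le_km : p k.+1 < (p m).+1 by have := p_lt m; have := ltp k m.+1; have := ltp m k.+1; lia.
  have Ek : p k.+1 = i + size r.
      have [||] := (rj (p k.+1 - i)).1; try by move: (p_lt k); lia.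
    by apply/occE; split; [rewrite size_cat; lia|rewrite subnKC //; move: (p_lt k); lia].
  have -> : r = blk k.
    have /occurs_cat[/occursE <- _] := occr.
    by rewrite /blk pk addn0 Ek addKn.
  by rewrite -blkE; apply: mem_nth; apply: bd.
split.
  by move=> i lt_i /pO[m pm]; have := ltp m 0; lia.
move=> j; rewrite !blkE; split=> //; first by rewrite size_slice subnKC // ltnW.
exact: occurs_slice.
Qed.

Definition letters_in k l (z : nat -> nat) := forall i, z i = k \/ z i = l.
Definition codeA (f : nat -> seq nat) k l := [/\ k <> l, f k = [:: k] & f l = [:: l; k]].
Definition codeB (f : nat -> seq nat) k l := [/\ k <> l, f k = [:: k] & f l = [:: k; l]].

Lemma codeA_at f k l z u j : codeA f k l -> letters_in k l z -> word_image f z u ->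
  u (bpos f z j) = z j /\
  ((z j = k /\ bpos f z j.+1 = (bpos f z j).+1) \/
   [/\ z j = l, u (bpos f z j).+1 = k & bpos f z j.+1 = (bpos f z j).+2]).
Proof.
move=> [kl fk fl] oz iz; have := image_at _ _ _ j iz; rewrite bposS.
case: (oz j) => ->; rewrite ?fk ?fl => /occurs_cons[->].
  by rewrite addn1; split=> //; left.
by case/occurs_cons=> -> _; rewrite addn2; split=> //; right.
Qed.

Lemma codeB_at f k l z u j : codeB f k l -> letters_in k l z -> word_image f z u ->
  u (bpos f z j) = k /\
  ((z j = k /\ bpos f z j.+1 = (bpos f z j).+1) \/
   [/\ z j = l, u (bpos f z j).+1 = l & bpos f z j.+1 = (bpos f z j).+2]).
Proof.
move=> [kl fk fl] oz iz; have := image_at _ _ _ j iz; rewrite bposS.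
case: (oz j) => ->; rewrite ?fk ?fl => /occurs_cons[->].
  by rewrite addn1; split=> //; left.
by case/occurs_cons=> -> _; rewrite addn2; split=> //; right.
Qed.

Lemma codeA_pos f k l z u i : nonerasing f -> codeA f k l -> letters_in k l z -> word_image f z u ->
  (exists2 j, i = bpos f z j & u i = z j) \/ (exists2 j, i.+1 = bpos f z j.+1 & u i = k).
Proof.
move=> ne cA oz iz; have [j [t [lt_t ->]]] := bpos_surj f z i ne.
have [uj] := codeA_at _ _ _ _ _ j cA oz iz; case: cA => _ fk fl.
case=> [[zj E]|[zj u1 E]].
  by left; exists j; move: lt_t; rewrite zj fk => /=; case: t; rewrite ?addn0 // uj zj.
move: lt_t; rewrite zj fl /=; case: t => [|[|]] // _.
  by left; exists j; rewrite ?addn0 // uj zj.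
by right; exists j; rewrite addn1.
Qed.

Lemma codeB_pos f k l z u i : nonerasing f -> codeB f k l -> letters_in k l z -> word_image f z u ->
  (exists2 j, i = bpos f z j & u i = k) \/
  (exists2 j, i = (bpos f z j).+1 & u i = l /\ z j = l).
Proof.
move=> ne cB oz iz; have [j [t [lt_t ->]]] := bpos_surj f z i ne.
have [uj] := codeB_at _ _ _ _ _ j cB oz iz; case: cB => _ fk fl.
case=> [[zj E]|[zj u1 E]].
  by left; exists j; move: lt_t; rewrite zj fk => /=; case: t; rewrite ?addn0 // uj zj.
move: lt_t; rewrite zj fl /=; case: t => [|[|]] // _.
  by left; exists j; rewrite ?addn0 // uj zj.
by right; exists j; rewrite addn1.
Qed.

Lemma codeA_decode f k l z u : codeA f k l -> letters_in k l z -> word_image f z u ->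
  forall v j, occurs u v (bpos f z j) ->
  exists v', size v' <= size v /\
    forall i, occurs u v (bpos f z i) <-> occurs z v' i.
Proof.
move=> cA oz iz v; have [n] := ubnP (size v); elim: n v => // n IH v lt_v j.
have at_ i := codeA_at _ _ _ _ _ i cA oz iz.
have kl : k <> l by case: cA.
case: v lt_v => [|c y] lt_v; first by exists [::].
case/occurs_cons=> uc oy; have [uj [[zj E]|[zj u1 E]]] := at_ j.
  have {uc}Ec : c = k by rewrite -uc uj.
  subst c; have [||y' [sy' y'E]] := IH y _ j.+1; rewrite ?E //.
  exists (k :: y'); split=> [|i]; first by rewrite /=; lia.
  rewrite !occurs_cons -y'E; have [-> [[zi ->]|[zi _ _]]] := at_ i; first by split.
  by rewrite zi; split=> -[Ek _]; case: kl.
have {uc}Ec : c = l by rewrite -uc uj.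
subst c; case: y lt_v oy => [|c y] lt_v.
  move=> _; exists [:: l]; split=> // i; rewrite !occurs_cons.
  by have [-> _] := at_ i; split=> -[].
case/occurs_cons=> uc1 oy; have {uc1}Ec : c = k by rewrite -uc1.
subst c; have [||y' [sy' y'E]] := IH y _ j.+1; rewrite ?E //; first by move: lt_v => /=; lia.
exists (l :: y'); split=> [|i]; first by rewrite /=; lia.
rewrite !occurs_cons -y'E; have [-> [[zi _]|[zi -> ->]]] := at_ i.
  by rewrite zi; split=> -[Ek _]; case: kl.
by split=> -[? ?]; [split=> //; tauto|].
Qed.

Lemma codeB_decode f k l z u : codeB f k l -> letters_in k l z -> word_image f z u ->
  forall v j, v <> [::] -> occurs u v (bpos f z j) ->
  exists v', size v' < size v /\
    forall i, occurs u v (bpos f z i) <-> occurs z v' i.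
Proof.
move=> cB oz iz v; have [n] := ubnP (size v); elim: n v => // n IH v lt_v j.
have at_ i := codeB_at _ _ _ _ _ i cB oz iz.
have kl : k <> l by case: cB.
case: v lt_v => // c [|c' y] lt_v _ /occurs_cons[uc oy].
  exists [::]; split=> // i; rewrite occurs_cons -uc; have [-> _] := at_ i.
  by have [-> _] := at_ j; split.
have [uj [[zj E]|[zj u1 E]]] := at_ j.
  have {uc}Ec : c = k by rewrite -uc.
  have Ec' : c' = k.
    by move/occurs_cons: oy => [<- _]; rewrite -E; have [] := at_ j.+1.
  subst c c'; have [|||y' [sy' y'E]] := IH (k :: y) _ j.+1; rewrite ?E //.
  exists (k :: y'); split=> // i.
  rewrite (occurs_cons z) (occurs_cons u k) -y'E; have [-> [[zi ->]|[zi u1 _]]] := at_ i.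
    by rewrite zi.
  by rewrite occurs_cons u1 zi; split=> [[_ [El _]]|[El _]]; case: kl.
have {uc}Ec : c = k by rewrite -uc.
case/occurs_cons: oy; rewrite u1 => Ec' oy; subst c c'.
have [y' [sy' y'E]] : exists y', size y' <= size y /\
    forall i, occurs u y (bpos f z i) <-> occurs z y' i.
  case: y lt_v oy => [|c y] lt_v oy; first by exists [::].
  have [|||y' [sy' y'E]] := IH (c :: y) _ j.+1; rewrite ?E //; first by move: lt_v => /=; lia.
  by exists y'; split=> //; apply: ltnW.
exists (l :: y'); split=> [|i]; first by rewrite /=; lia.
rewrite !occurs_cons -y'E; have [-> [[zi E']|[zi -> ->]]] := at_ i.
  have [E'' _] := at_ i.+1; rewrite -E' E'' zi.
  by split=> [[_ []]|[]].
by rewrite zi; split=> -[]; tauto.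
Qed.

Lemma codeA_reduce_tail f k l z u y : nonerasing f -> morph_inj f -> binary z ->
  codeA f k l -> letters_in k l z -> word_image f z u -> factor (k :: y) u ->
  exists v', [/\ size v' <= size y, factor v' (shift z) &
    forall d, coded (shift z) (occurs (shift z) v') d -> coded u (occurs u (k :: y)) d].
Proof.
move=> ne inj bz cA oz iz [i oi].
have kl : k <> l by case: cA.
have at_ i0 := codeA_at _ _ _ _ _ i0 cA oz iz.
have endk i0 : u i0 = k -> exists j, i0.+1 = bpos f z j.+1.
  move=> ui; have [[j Ej uj]|[j Ej _]] := codeA_pos _ _ _ _ _ i0 ne cA oz iz; last by exists j.
  exists j; rewrite Ej; have [_ [[_ ->]//|[zj _ _]]] := at_ j.
  by case: kl; rewrite -ui uj.
have kend j : exists2 i0, bpos f z j.+1 = i0.+1 & u i0 = k.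
  have [uj [[zj ->]|[zj u1 ->]]] := at_ j; first by exists (bpos f z j); rewrite // uj.
  by exists (bpos f z j).+1.
have [v' [sv' v'E]] : exists v', size v' <= size y /\
    forall i, occurs u y (bpos f z i) <-> occurs z v' i.
  case/occurs_cons: oi => /endk[j ->] oy; exact: (codeA_decode _ _ _ _ _ cA oz iz _ _ oy).
exists v'; split=> //.
  by case/occurs_cons: oi => /endk[j ->] /v'E oy; exists j.
move=> d cd.
pose O1 n := exists2 o, occurs z v' o.+1 & n = o.+1.
have c1 : coded z O1 d by apply: coded_shift cd _ => n.
pose O2 n := exists2 o, O1 o & n = bpos f z o.
have c2 : coded u O2 d by apply: coded_image c1.
apply/(coded_succ u _ O2 d k); [|move=> n; split|by []].
- by move=> o /occurs_cons[].
- case=> _ [o oz1 ->] ->; have [i0 Ei ui] := kend o; exists i0 => //.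
  by apply/occurs_cons; rewrite -Ei; split=> //; apply/v'E.
- case=> o /occurs_cons[uo oy] ->; have [j Ej] := endk _ uo.
  exists j.+1; rewrite // /O1; exists j => //; apply/v'E; by rewrite -Ej.
Qed.

Lemma codeA_reduce f k l z u y : nonerasing f -> morph_inj f -> binary z ->
  codeA f k l -> letters_in k l z -> word_image f z u -> factor (l :: y) u ->
  exists v', [/\ size v' < size (l :: y) \/ (y = [::] /\ v' = [:: l]), factor v' z &
    forall d, coded z (occurs z v') d -> coded u (occurs u (l :: y)) d].
Proof.
move=> ne inj bz cA oz iz [i oi].
have kl : k <> l by case: cA.
have at_ i0 := codeA_at _ _ _ _ _ i0 cA oz iz.
have bndl i0 : u i0 = l -> exists j, i0 = bpos f z j.
  move=> ui; have [[j Ej _]|[j _ uk]] := codeA_pos _ _ _ _ _ i0 ne cA oz iz; first by exists j.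
  by case: kl; rewrite -uk.
have [j Ei] : exists j, i = bpos f z j by case/occurs_cons: oi => /bndl.
subst i; have [v' [sv' v'E]] : exists v',
    (size v' < size (l :: y) \/ (y = [::] /\ v' = [:: l])) /\
    forall i, occurs u (l :: y) (bpos f z i) <-> occurs z v' i.
  case: y oi => [|c y].
    move=> _; exists [:: l]; split=> [|i]; first by right.
    by rewrite !occurs_cons; have [-> _] := at_ i; split=> -[].
  case/occurs_cons=> uj /occurs_cons[uc oy].
  have [uj' [[zj _]|[zj uk E]]] := at_ j; first by case: kl; rewrite -uj uj'.
  rewrite -E in oy; have [y' [sy' y'E]] := codeA_decode _ _ _ _ _ cA oz iz _ _ oy.
  exists (l :: y'); split=> [|i]; first by left; rewrite /=; lia.
  rewrite !occurs_cons -y'E -uc uk; have [-> [[zi _]|[zi -> ->]]] := at_ i.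
    by rewrite zi; split=> -[].
  by split=> -[]; tauto.
exists v'; split=> //; first by exists j; apply/v'E.
move=> d; apply: coded_image => // n; split=> [on|[o oz' ->]]; last by apply/v'E.
have /bndl[o Eo] : u n = l by case/occurs_cons: on.
by exists o => //; apply/v'E; rewrite -Eo.
Qed.

Lemma codeB_reduce f k l z u c y : nonerasing f -> morph_inj f -> binary z ->
  codeB f k l -> letters_in k l z -> word_image f z u -> factor (c :: y) u ->
  exists v', [/\ size v' < size (c :: y) \/ [/\ c = l, y = [::] & v' = [:: l]],
    factor v' z &
    forall d, coded z (occurs z v') d -> coded u (occurs u (c :: y)) d].
Proof.
move=> ne inj bz cB oz iz [i oi].
have kl : k <> l by case: cB.
have at_ i0 := codeB_at _ _ _ _ _ i0 cB oz iz.
have bndk i0 : u i0 = k -> exists j, i0 = bpos f z j.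
  move=> ui; have [[j Ej _]|[j _ [ul _]]] := codeB_pos _ _ _ _ _ i0 ne cB oz iz; first by exists j.
  by case: kl; rewrite -ui.
have [[j Ei ui]|[j Ei [ui zj]]] := codeB_pos _ _ _ _ _ i ne cB oz iz; subst i.
  have {}ui : c = k by case/occurs_cons: oi => <-.
  subst c; have [|v' [sv' v'E]] := codeB_decode _ _ _ _ _ cB oz iz _ _ _ oi => //.
  exists v'; split; [by left|by exists j; apply/v'E|].
  move=> d; apply: coded_image => // n; split=> [on|[o oz' ->]]; last by apply/v'E.
  have /bndk[o Eo] : u n = k by case/occurs_cons: on.
  by exists o => //; apply/v'E; rewrite -Eo.
have {}ui : c = l by case/occurs_cons: oi => <-.
subst c; have [_ [[zk _]|[_ ul E]]] := at_ j; first by case: kl; rewrite -zk.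
have [v' [sv' v'E]] : exists v',
    (size v' < size (l :: y) \/ (y = [::] /\ v' = [:: l])) /\
    forall i, (z i = l /\ occurs u (l :: y) (bpos f z i).+1) <-> occurs z v' i.
  case/occurs_cons: oi => _; rewrite -E; case: y => [|c y] oy.
    exists [:: l]; split=> [|i]; first by right.
    rewrite !occurs_cons; have [_ [[zi _]|[zi -> _]]] := at_ i.
      by rewrite zi; split=> -[].
    by split=> -[].
  have [|y' [sy' y'E]] := codeB_decode _ _ _ _ _ cB oz iz _ _ _ oy => //.
  exists (l :: y'); split=> [|i]; first by left.
  rewrite !(occurs_cons _ l) -y'E; have [_ [[zi _]|[zi -> ->]]] := at_ i.
    by rewrite zi; split=> -[].
  by split=> -[]; tauto.
exists v'; split=> //.
- by case: sv' => [|[-> ->]]; [left|right].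
- by exists j; apply/v'E.
move=> d cd; pose O1 n := exists2 o, occurs z v' o & n = bpos f z o.
have c1 : coded u O1 d by apply: coded_image cd.
apply: (proj1 (coded_succ u O1 _ d k _ _) c1).
  by move=> _ [o _ ->]; have [] := at_ o.
move=> n; split=> [on|[_ [o /v'E[_ ov'] ->] ->] //].
have un : u n = l by case/occurs_cons: on.
have [[i _ uk]|[i Ei [_ zi]]] := codeB_pos _ _ _ _ _ n ne cB oz iz.
  by case: kl; rewrite -uk.
by exists (bpos f z i) => //; exists i => //; apply/v'E; rewrite -Ei.
Qed.

(* With [k := ty x] and [l] the other letter, [phi x] fixes [k] and sends [l] to
   [l k] if [isA x], and to [k l] otherwise. *)
Definition ty x := match x with La | Lb => 0 | _ => 1 end.
Definition isA x := match x with La | Lalpha => true | _ => false end.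

Lemma ty_lt2 x : ty x < 2. Proof. by case: x. Qed.

Lemma phi_codeA x : isA x -> codeA (phi x) (ty x) (1 - ty x).
Proof. by case: x. Qed.

Lemma phi_codeB x : ~~ isA x -> codeB (phi x) (ty x) (1 - ty x).
Proof. by case: x. Qed.

Lemma letters_in_ty x z : binary z -> letters_in (ty x) (1 - ty x) z.
Proof. by move=> bz i; have := bz i; have := ty_lt2 x; lia. Qed.

Lemma phi_nonerasing x : nonerasing (phi x).
Proof. by case: x; case. Qed.

Lemma phi_lt2 x c : all (gtn 2) (phi x c).
Proof. by case: x; case: c. Qed.

Definition toB x := match x with La | Lb => Lb | _ => Lbeta end.

Lemma morph_phi_toB x s : isA x ->
  ty x :: morph (phi x) s = rcons (morph (phi (toB x)) s) (ty x).
Proof.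
move=> Ax; elim: s => //= c s.
rewrite -[c :: s]cat1s !morph_cat rcons_cat => <-.
by case: x Ax; case: c.
Qed.

Lemma phi_inj x : morph_inj (phi x).
Proof.
have injA y : isA y -> morph_inj (phi y).
  move=> Ay; elim=> [|c s IH] [|d t] //=.
  - by move=> _ _; case: y Ay => // _; case: d => [|[|]].
  - by move=> _ _; case: y Ay {IH} => // _; case: c => [|[|]].
  move=> /andP[c2 s2] /andP[d2 t2]; rewrite -[c :: s]cat1s -[d :: t]cat1s !morph_cat.
  have {}IH := IH t s2 t2.
  case: y Ay IH => // _ IH; case: c c2 => [|[|]] // _; case: d d2 => [|[|]] // _;
    by case=> /IH ->.
have [Ax|nAx] := boolP (isA x); first exact: injA.
have [y Ay Ey] : exists2 y, isA y & x = toB y.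
  by case: x nAx => // _; [exists La|exists Lalpha].
move=> s t s2 t2; rewrite Ey => E; apply: (injA _ Ay) => //.
have := morph_phi_toB _ s Ay; rewrite E -morph_phi_toB //.
by case.
Qed.

Notation phiw w := (img (phi_w w)).

Lemma phiw_foldr w s : foldr (fun x s => morph (phi x) s) s w = morph (phiw w) s.
Proof.
elim: w => [|x w IH] /=; first by elim: s => //= c s; rewrite /morph /= => {1}->.
by rewrite IH -morph_comp.
Qed.

Lemma phiw_rcons w x c : phiw (rcons w x) c = morph (phiw w) (phi x c).
Proof. by rewrite /= foldr_rcons phiw_foldr /morph /= cats0. Qed.

Lemma phiw_nonerasing w : nonerasing (phiw w).
Proof.
elim: w => [|x w IH] c //=.
exact: leq_trans (IH c) (size_morph_ge _ _ (phi_nonerasing x)).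
Qed.

Lemma phiw_lt2 w c : c < 2 -> all (gtn 2) (phiw w c).
Proof.
case: w => [|x w] c2 /=; first by rewrite c2.
rewrite /morph; elim: (foldr _ _ _) => //= d s IH; by rewrite all_cat phi_lt2.
Qed.

Lemma image_binary f z u : nonerasing f -> (forall c, c < 2 -> all (gtn 2) (f c)) ->
  binary z -> word_image f z u -> binary u.
Proof.
move=> ne f2 bz iz i; have [j [t [lt_t ->]]] := bpos_surj f z i ne.
by rewrite (image_at _ _ _ j iz) //; apply: (allP (f2 _ (bz j))); apply: mem_nth.
Qed.

Lemma image_phiw_cons x w z u : word_image (phiw (x :: w)) z u ->
  exists y, word_image (phiw w) z y /\ word_image (phi x) y u.
Proof. by apply: image_decomp; apply: phiw_nonerasing. Qed.

Definition fixed w u := binary u /\ word_image (phiw w) u u.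

Lemma fixedE w u : fixed w u <-> fixed_point (phi_w w) u.
Proof.
by split=> -[bu H]; split=> // n t lt_t; rewrite ?add0n -?(H n t lt_t).
Qed.

Lemma fixed_rot x w u : fixed (x :: w) u ->
  exists2 y, fixed (rcons w x) y & word_image (phi x) y u.
Proof.
move=> [bu /image_phiw_cons[y [iy ix]]]; exists y => //; split.
  exact: image_binary (phiw_nonerasing w) (phiw_lt2 w) bu iy.
move=> n; have := image_comp _ _ _ _ _ ix iy n.
by rewrite /morph (eq_map (phiw_rcons w x)).
Qed.

Definition lower c x := if ty x == c then x else toB x.

Lemma ty_lower c x : ty (lower c x) = ty x.
Proof. by rewrite /lower; case: ifP; case: x. Qed.

Lemma morph_lower x c s : c < 2 -> isA x || (ty x == c) -> exists e,
  morph (phi x) (c :: s) = c :: morph (phi (lower c x)) s ++ e.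
Proof.
move=> c2; rewrite orbC /lower; case: eqP => /= [<- _|nxc Ax].
  by exists [::]; rewrite cats0 -cat1s morph_cat; case: x.
exists [:: ty x]; rewrite cats1 -morph_phi_toB // -cat1s morph_cat.
by case: x nxc Ax => //; case: c c2 => [|[|]].
Qed.

Lemma image_lower1 x c z u : binary z -> isA x || (ty x == c) -> z 0 = c ->
  word_image (phi x) z u ->
  u 0 = c /\ word_image (phi (lower c x)) (shift z) (shift u).
Proof.
move=> bz xc z0 iz; have c2 : c < 2 by rewrite -z0.
have H n : u 0 = c /\ occurs u (morph (phi (lower c x)) (mkseq (shift z) n)) 1.
  have := iz n.+1; rewrite -slice0 sliceS z0.
  by have [e ->] := morph_lower x c (slice z 1 n) c2 xc; case/occurs_cons => -> /occurs_cat[].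
by split=> [|n]; [have [] := H 0|have [_] := H n].
Qed.

Lemma image_lower w c z u : binary z -> all (fun x => isA x || (ty x == c)) w -> z 0 = c ->
  word_image (phiw w) z u ->
  u 0 = c /\ word_image (phiw (map (lower c) w)) (shift z) (shift u).
Proof.
have idE s : morph (phiw [::]) s = s by rewrite -phiw_foldr.
move=> bz; elim: w u => [|x w IH] u.
  move=> _ z0 iz; have E i : u i = z i.
    have := iz i.+1; rewrite idE -slice0 occursE size_slice => Ei.
    have := congr1 (fun s => nth 0 s i) Ei; by rewrite !nth_mkseq.
  split=> [|n]; first by rewrite E.
  rewrite idE => t; rewrite size_mkseq => lt_t.
  by rewrite nth_mkseq // /shift E.
move=> /andP[xc wc] z0 /image_phiw_cons[y [iy ix]].
have [y0 iy'] := IH y wc z0 iy.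
have by_ := image_binary _ _ _ (phiw_nonerasing w) (phiw_lt2 w) bz iy.
have [u0 ix'] := image_lower1 _ _ _ _ by_ xc y0 ix; split=> //.
exact: image_comp iy' ix'.
Qed.

Lemma fixed_lower w u : fixed w u -> all (fun x => isA x || (ty x == u 0)) w ->
  fixed (map (lower (u 0)) w) (shift u).
Proof.
move=> [bu iu] wc; split; first by move=> i; apply: bu.
by have [] := image_lower _ _ _ _ bu wc erefl iu.
Qed.

(* [g] selects, for each of the types 0 and 1, which of its two letters occurs. *)
Definition in_class (g : nat -> bool) := all (fun x => isA x == g (ty x)).
Definition mixed w := has (fun x => ty x == 0) w && has (fun x => ty x == 1) w.
Definition four_classes w :=
  [|| all is_b_beta w, all is_b_alpha w, all is_a_beta w | all is_a_alpha w].

Lemma four_classesP w : four_classes w <-> exists g, in_class g w.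
Proof.
split.
  by case/or4P=> H; [exists (fun=> false)|exists (fun i => i == 1)|
    exists (fun i => i == 0)|exists (fun=> true)]; apply: sub_all H; case.
case=> g H; apply/or4P; case E0: (g 0); case E1: (g 1);
  [apply: Or44|apply: Or43|apply: Or42|apply: Or41]; apply: sub_all H; case=> /=;
  by rewrite ?E0 ?E1.
Qed.

Lemma mixedE w c : c < 2 -> mixed w -> has (fun x => ty x == c) w.
Proof. by case: c => [|[|]] // _ /andP[]. Qed.

Lemma mixed_rcons x w : mixed (rcons w x) = mixed (x :: w).
Proof. by rewrite /mixed !has_rcons. Qed.

Lemma in_class_rcons g x w : in_class g (rcons w x) = in_class g (x :: w).
Proof. by rewrite /in_class all_rcons. Qed.

Lemma mixed_lower c w : mixed (map (lower c) w) = mixed w.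
Proof. by rewrite /mixed !has_map; congr (_ && _); apply: eq_has => x /=; rewrite ty_lower. Qed.

Lemma in_class_lower g c w : in_class g w ->
  in_class (fun i => (i == c) && g i) (map (lower c) w).
Proof.
rewrite /in_class all_map; apply: sub_all => x /eqP Ax /=.
by rewrite ty_lower /lower; case: (ty x == c) => /=; [rewrite Ax|case: x {Ax}].
Qed.

Lemma head_morph f s : nonerasing f -> s != [::] ->
  head 0 (morph f s) = head 0 (f (head 0 s)).
Proof. by case: s => // c s ne _; rewrite /morph /=; have := ne c; case: (f c). Qed.

Lemma phiw_neq_nil w c : phiw w c != [::].
Proof. by rewrite -size_eq0 -lt0n; apply: phiw_nonerasing. Qed.

Lemma head_phiw_cons x w c :
  head 0 (phiw (x :: w) c) = head 0 (phi x (head 0 (phiw w c))).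
Proof. exact: head_morph (phi_nonerasing x) (phiw_neq_nil w c). Qed.

Lemma head_phiA x c : isA x -> c < 2 -> head 0 (phi x c) = c.
Proof. by case: x => // _; case: c => [|[|]]. Qed.

Lemma head_phiB x c : ~~ isA x -> head 0 (phi x c) = ty x.
Proof. by case: x => // _; case: c. Qed.

Lemma head_phiw_B g w l c : in_class g w -> ~~ g l -> l < 2 ->
  (forall i, i != l -> i < 2 -> g i) -> has (fun x => ty x == l) w -> head 0 (phiw w c) = l.
Proof.
move=> cw gl l2 gk; elim: w cw => // x w IH /andP[/eqP Ax cw].
rewrite head_phiw_cons; have [El|nl] := eqVneq (ty x) l.
  by move=> _; rewrite head_phiB // Ax El.
rewrite /= (negPf nl) /= => hw; rewrite IH // head_phiA // Ax; exact: gk (ty_lt2 x).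
Qed.

Lemma fixed_head w u : fixed w u -> u 0 = head 0 (phiw w (u 0)).
Proof.
move=> [bu iu]; have := image_at _ _ _ 0 iu; have := phiw_neq_nil w (u 0).
by case: (phiw w (u 0)) => // c s _ /occurs_cons[].
Qed.

Lemma fixed_lowerable g k w u : in_class g w -> mixed w -> g k -> k < 2 -> fixed w u ->
  all (fun x => isA x || (ty x == u 0)) w.
Proof.
move=> cw mw gk k2 fu.
have kE i : i < 2 -> i = k \/ i = 1 - k by lia.
case gl: (g (1 - k)).
  apply: sub_all cw => x /eqP->; case: (kE _ (ty_lt2 x)) => ->; by rewrite ?gk ?gl.
have u0 : u 0 = 1 - k.
  rewrite (fixed_head _ _ fu); apply: (head_phiw_B g) => //; rewrite ?gl //; try lia.
    by move=> i ni /kE[->//|Ei]; move: ni; rewrite Ei eqxx.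
  by apply: mixedE => //; lia.
apply: sub_all cw => x /eqP->; rewrite u0.
by case: (kE _ (ty_lt2 x)) => ->; rewrite ?gk ?eqxx ?orbT.
Qed.

Lemma mem_morph f s d b : d \in s -> b \in f d -> b \in morph f s.
Proof. by move=> ds bd; apply/flattenP; exists (f d) => //; apply: map_f. Qed.

Lemma mem_phiw w b c : b < 2 -> has (fun x => ty x == b) w -> b \in phiw w c.
Proof.
move=> b2; elim: w => //= x w IH; have [<- _|_ /IH bw] := eqVneq (ty x) b.
  have := phiw_neq_nil w c; rewrite /=; case: (foldr _ _ _) => // d s _.
  by apply: (mem_morph _ _ d); rewrite ?mem_head //; case: x; case: d.
by apply: mem_morph bw _; case: x; case: b b2 {IH} => [|[|]].
Qed.

Lemma mixed_primitive w : mixed w -> primitive (phi_w w).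
Proof.
move=> mw; exists 1; split=> // a b _ b2.
by rewrite /iter_img /= /morph /= cats0; apply: mem_phiw (mixedE _ _ _ mw).
Qed.

Lemma phiw_pure w a : all (fun x => ty x == a) w -> phiw w a = [:: a].
Proof. by elim: w => //= x w IH /andP[/eqP xa /IH->]; rewrite -xa; case: x {xa}. Qed.

Lemma primitive_mixed w : primitive (phi_w w) -> mixed w.
Proof.
move=> [p [_ pw]].
suff H b : b < 2 -> has (fun x => ty x == b) w by rewrite /mixed !H.
move=> b2; apply/negPn/negP; rewrite -all_predC => nb.
have aw : all (fun x => ty x == 1 - b) w.
  by apply: sub_all nb => x /=; have := ty_lt2 x; lia.
have E : iter_img (phi_w w) p (1 - b) = [:: 1 - b].
  rewrite /iter_img; elim: p {pw} => // p /= ->.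
  by rewrite /morph /= cats0; apply: phiw_pure.
have := pw (1 - b) b; rewrite E inE /=; lia.
Qed.

Lemma phiw_head_fixed w : exists2 c, c < 2 & head 0 (phiw w c) = c.
Proof.
have : (forall c, c < 2 -> head 0 (phiw w c) = c) \/
       exists2 e, e < 2 & forall c, c < 2 -> head 0 (phiw w c) = e.
  elim: w => [|x w IH]; first by left.
  have [Ax|Bx] := boolP (isA x).
    case: IH => [IH|[e e2 IH]].
      by left=> c c2; rewrite head_phiw_cons IH // head_phiA.
    by right; exists e => // c c2; rewrite head_phiw_cons IH // head_phiA.
  by right; exists (ty x); [apply: ty_lt2|move=> c _; rewrite head_phiw_cons head_phiB].
by case=> [H|[e e2 H]]; [exists 0; rewrite // H|exists e; rewrite // H].
Qed.

Lemma size_phiw_mixed w c : mixed w -> 1 < size (phiw w c).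
Proof.
move=> mw; have b0 := mem_phiw w 0 c isT (mixedE w 0 isT mw).
have := mem_phiw w 1 c isT (mixedE w 1 isT mw).
by case: (phiw w c) b0 => [|d [|e s]] //; rewrite !inE => /eqP<-.
Qed.

Lemma mixed_substitution w : mixed w -> is_substitution (phi_w w).
Proof.
move=> mw; have [c c2 hc] := phiw_head_fixed w; exists c; split=> //; split.
  have := size_phiw_mixed w c mw; move: hc; case: (phiw w c) => [|d [|e s]] //= -> _.
  by exists (e :: s).
have grow s : 2 * size s <= size (morph (phiw w) s).
  elim: s => // d s IH; have Ed : morph (phiw w) [:: d] = phiw w d by rewrite -phiw_foldr.
  rewrite -cat1s morph_cat Ed !size_cat (_ : size [:: d] = 1) //.
  by have := size_phiw_mixed w d mw; lia.
move=> N; exists N; rewrite /iter_img.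
suff : N < size (iter N (morph (phiw w)) [:: c]) by apply: ltnW.
by elim: N => // N IH; rewrite iterS; apply: leq_trans (grow _); lia.
Qed.

Lemma wf_phi_w w : wf_morphism (phi_w w).
Proof. by move=> c; apply: phiw_lt2. Qed.

Lemma fixed_has_letter w u b : mixed w -> fixed w u -> b < 2 -> exists i, u i = b.
Proof.
move=> mw [bu iu] b2; have /(nthP 0)[t lt_t Et] := mem_phiw w b (u 0) b2 (mixedE _ _ b2 mw).
by exists (bpos (phiw w) u 0 + t); rewrite -Et; apply: (image_at _ _ _ 0 iu).
Qed.

Lemma find_rot (P : pred sturm) x w : ~~ P x -> has P w ->
  find P (rcons w x) < find P (x :: w).
Proof. by move=> /= /negPf-> hw; rewrite -cats1 find_cat hw. Qed.

Lemma fixed_coded w u v : four_classes w -> mixed w -> fixed w u -> factor v u ->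
  exists w' d, [/\ four_classes w', mixed w', size w' = size w, fixed w' d &
    coded u (occurs u v) d].
Proof.
pose m v w := size v * (size w).+1 + find (fun x => ty x == head 0 v) w.
have [n] := ubnP (m v w); elim: n w u v => // n IH w u v lt_n fw mw fu vu.
case: v => [|c y] in lt_n vu *.
  exists w, u; split=> //; apply: coded_all; first by have [] := fu.
    exact: fixed_has_letter mw fu _.
  exact: fixed_has_letter mw fu _.
have [g gw] := (four_classesP w).1 fw.
case: w => [|x w] in lt_n fw mw fu gw *; first by [].
have [z fz iz] := fixed_rot _ _ _ fu.
have gw' : in_class g (rcons w x) by rewrite in_class_rcons.
have mw' : mixed (rcons w x) by rewrite mixed_rcons.
have fw' : four_classes (rcons w x) by apply/four_classesP; exists g.
have [bz _] := fz.
have m_lt v' w' : size w' = size (x :: w) -> size v' < size (c :: y) -> m v' w' < n.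
  move=> sw' sv'; move: lt_n; rewrite /m sw'.
  have := find_size (fun x => ty x == head 0 v') w'; rewrite sw' => ?.
  have : (size v').+1 * (size (x :: w)).+1 <= size (c :: y) * (size (x :: w)).+1.
    by rewrite leq_mul2r sv' orbT.
  rewrite mulSn; lia.
have x2 := ty_lt2 x.
have [v' [z' [w' [lt_m fw'' mw'' [sw' fz' vz' cd]]]]] : exists v' z' w',
    [/\ m v' w' < n, four_classes w', mixed w' &
     [/\ size w' = size (x :: w), fixed w' z', factor v' z' &
     forall d, coded z' (occurs z' v') d -> coded u (occurs u (c :: y)) d]].
  have ne := phi_nonerasing x; have inj := phi_inj x.
  have lz := letters_in_ty x z bz.
  have stay v' : size v' < size (c :: y) \/ [/\ c = 1 - ty x, y = [::] & v' = [:: 1 - ty x]] ->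
      m v' (rcons w x) < n.
    case=> [|[Ec Ey ->]]; first by apply: m_lt; rewrite size_rcons.
    move: lt_n; rewrite Ec Ey /m size_rcons /= !mul1n => lt_n.
    have := find_rot (fun x0 => ty x0 == 1 - ty x) x w.
    have : has (fun x0 => ty x0 == 1 - ty x) (x :: w) by apply: mixedE => //; lia.
    have nx : ty x != 1 - ty x by lia.
    rewrite /= (negPf nx) /= => -> /(_ isT isT); move: lt_n; rewrite /= (negPf nx); lia.
  have [Ax|Bx] := boolP (isA x).
    have cA := phi_codeA x Ax; have [bu _] := fu.
    have [Ec|Ec] : c = ty x \/ c = 1 - ty x.
      have [i /occurs_cons[ui _]] := vu; move: (bu i); rewrite ui; lia.
      subst c; have [v' [sv' vz' cd]] := codeA_reduce_tail _ _ _ _ _ _ ne inj bz cA lz iz vu.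
      exists v', (shift z), (map (lower (z 0)) (rcons w x)); split.
      - by apply: m_lt; rewrite // size_map size_rcons.
      - by apply/four_classesP; eexists; apply: in_class_lower gw'.
      - by rewrite mixed_lower.
      split=> //; first by rewrite size_map size_rcons.
      apply: (fixed_lower _ _ fz); apply: (fixed_lowerable g (ty x)) => //.
      by move: gw => /andP[/eqP <-].
    subst c; have [v' [sv' vz' cd]] := codeA_reduce _ _ _ _ _ _ ne inj bz cA lz iz vu.
    exists v', z, (rcons w x); split=> //; last by rewrite size_rcons.
    by apply: stay; case: sv' => [|[]]; [left|right].
  have [v' [sv' vz' cd]] :=
    codeB_reduce _ _ _ _ _ _ _ ne inj bz (phi_codeB x Bx) lz iz vu.
  exists v', z, (rcons w x); split=> //; last by rewrite size_rcons.
  exact: stay.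
have [w0 [d [? ? ? ? ?]]] := IH _ _ _ lt_m fw'' mw'' fz' vz'.
exists w0, d; split=> //; [by rewrite -sw'|exact: cd].
Qed.

Fixpoint words n : seq (seq sturm) :=
  if n is m.+1 then
    List.flat_map (fun x => List.map (cons x) (words m)) [:: La; Lb; Lalpha; Lbeta]
  else [:: [::]].

Lemma In_words n w : List.In w (words n) <-> size w = n.
Proof.
split.
  elim: n w => [|n IH] w; first by case=> // <-.
  by case/List.in_flat_map=> x [_ /List.in_map_iff[w' [<- /IH <-]]].
elim: n w => [|n IH] [|x w] // => [_|[/IH Iw]]; first by left.
apply/List.in_flat_map; exists x; split; last exact: List.in_map.
by case: x; rewrite /=; auto.
Qed.

Theorem theorem24 (w : seq sturm) :
  [|| all is_b_beta w, all is_b_alpha w, all is_a_beta w | all is_a_alpha w] ->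
  primitive (phi_w w) -> is_substitution (phi_w w) ->
  closeable (phi_w w).
Proof.
move=> fw /primitive_mixed mw _.
pose ok w' := four_classes w' && mixed w'.
exists (List.map phi_w (List.filter ok (words (size w)))).
have InM w' : four_classes w' -> mixed w' -> size w' = size w ->
    List.In (phi_w w') (List.map phi_w (List.filter ok (words (size w)))).
  move=> fw' mw' sw'; apply: List.in_map; apply/List.filter_In.
  by split; [apply/In_words|rewrite /ok fw' mw'].
split; last exact: InM.
move=> s /List.in_map_iff[w1 [<- /List.filter_In[Iw1 /andP[fw1 mw1]]]].
split; [exact: wf_phi_w|exact: mixed_primitive|exact: mixed_substitution|].
move=> u /fixedE fu v vu.
have [w2 [d [fw2 mw2 sw2 fd cd]]] := fixed_coded _ _ _ fw1 mw1 fu vu.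
exists (phi_w w2); split; first by apply: InM; rewrite // sw2; apply/In_words.
split; first exact: mixed_primitive.
by exists d; split; [apply: coded_derived|apply/fixedE].
Qed.
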